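(* Let $G$ be a finitely generated group and $\{H_\lambda\}_{\lambda\in\Lambda}$ a collection of nontrivial subgroups of $G$. Suppose that $G$ is finitely presented with respect to $\{H_\lambda\}_{\lambda\in\Lambda}$. Then the following conditions hold. 1) The collection of subgroups is finite, i.e., $\mathrm{card}\,\Lambda<\infty$. 2) Each subgroup $H_\lambda$ is finitely generated.
   Context: A subset $X\subseteq G$ is a relative generating set of $G$ with respect to $\{H_\lambda\}_{\lambda\in\Lambda}$ if $G$ is generated by $X\cup\bigcup_{\lambda\in\Lambda}H_\lambda$. In this case put $F=(\ast_{\lambda\in\Lambda}\widetilde H_\lambda)\ast F(X)$, where $\widetilde H_\lambda$ is an isomorphic copy of $H_\lambda$ and $F(X)$ is the free group with basis $X$, and let $\varepsilon:F\to G$ be the canonical epimorphism. $G$ has the relative presentation $\langle X, H_\lambda,\lambda\in\Lambda \mid R=1, R\in\mathcal R\rangle$ if the kernel of $\varepsilon$ is the normal closure of $\mathcal R$ in $F$. The relative presentation is finite if both $X$ and $\mathcal R$ are finite. $G$ is finitely presented with respect to $\{H_\lambda\}_{\lambda\in\Lambda}$ if it admits a finite relative presentation with respect to $\{H_\lambda\}_{\lambda\in\Lambda}$. *)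

(* Defs.v *)
From HB Require Import structures.
From mathcomp Require Import all_boot.
From mathcomp Require Import boolp classical_sets functions cardinality.

Set Implicit Arguments.
Unset Strict Implicit.
Unset Printing Implicit Defensive.

Local Open Scope classical_set_scope.
Local Open Scope quotient_scope.
Local Open Scope group_scope.

Section Subgroups.
Variable G : groupType.
Implicit Types A K : set G.

Definition is_subgroup K : Prop :=
  K 1 /\ forall x y, K x -> K y -> K (x / y).

Definition is_normal_subgroup K : Prop :=
  is_subgroup K /\ forall x g, K x -> K (x ^ g).

Definition subgroup_generated A : set G := smallest is_subgroup A.

Definition normal_closure A : set G := smallest is_normal_subgroup A.

Definition finitely_generated : Prop :=
  exists A : set G, finite_set A /\ subgroup_generated A = [set: G].

End Subgroups.

Definition kernel (G H : groupType) (f : {multiplicative G -> H}) : set G :=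
  [set x | f x = 1].

Section SubgroupType.
Variables (G : groupType) (K : groupClosed G).

Record subgroup_type :=
  Subgroup { subgroup_incl : G; subgroup_inclP : subgroup_incl \in K }.

HB.instance Definition _ := [isSub for subgroup_incl].
HB.instance Definition _ := [Choice of subgroup_type by <:].

Lemma subgroup_closed : group_closed (fun x => x \in K).
Proof. by split; [exact: gpred1 | exact: gpredF]. Qed.

HB.instance Definition _ :=
  SubChoice_isSubGroup.Build G (fun x => x \in K) subgroup_type subgroup_closed.

Definition subgroup_inclusion : {multiplicative subgroup_type -> G} := \val.

End SubgroupType.

(* The group <A | r> given by generators and relators, as the quotient of the *)
(* words in the letters a^{+1} = (a, true) and a^{-1} = (a, false).           *)
Section PresentedGroup.
Variable A : Type.

Definition letter := (A * bool)%type.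
HB.instance Definition _ := gen_eqMixin letter.
HB.instance Definition _ := gen_choiceMixin letter.

Definition word := seq letter.
HB.instance Definition _ := Choice.on word.

Definition letterV (x : letter) : letter := (x.1, ~~ x.2).
Definition wordV (w : word) : word := rev (map letterV w).

Variable r : set word.

Inductive word_eq : word -> word -> Prop :=
| word_eq_refl u : word_eq u u
| word_eq_sym u v : word_eq u v -> word_eq v u
| word_eq_trans u v w : word_eq u v -> word_eq v w -> word_eq u w
| word_eq_cat u u' v v' :
    word_eq u u' -> word_eq v v' -> word_eq (u ++ v) (u' ++ v')
| word_eq_cancel x : word_eq [:: x; letterV x] [::]
| word_eq_relator w : r w -> word_eq w [::].

Definition word_eqb (u v : word) : bool := `[< word_eq u v >].

Lemma word_eqb_refl : reflexive word_eqb.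
Proof. by move=> u; apply/asboolP; exact: word_eq_refl. Qed.

Lemma word_eqb_sym : symmetric word_eqb.
Proof. by move=> u v; apply/asboolP/asboolP; exact: word_eq_sym. Qed.

Lemma word_eqb_trans : transitive word_eqb.
Proof.
move=> v u w /asboolP uv /asboolP vw.
by apply/asboolP; exact: word_eq_trans uv vw.
Qed.

Canonical word_equiv := EquivRel word_eqb word_eqb_refl word_eqb_sym word_eqb_trans.

Definition presented := {eq_quot word_equiv}.
HB.instance Definition _ := Choice.on presented.
HB.instance Definition _ := EqQuotient.on presented.

Definition presented_of (w : word) : presented := \pi_presented w.

Lemma presented_eq u v : presented_of u = presented_of v <-> word_eq u v.
Proof.
rewrite /presented_of; split; first by move/eqmodP/asboolP.
by move=> uv; apply/eqmodP/asboolP.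
Qed.

Lemma presentedP (x : presented) : exists w, x = presented_of w.
Proof. by exists (repr x); rewrite /presented_of reprK. Qed.

Lemma repr_presented w : word_eq (repr (presented_of w)) w.
Proof. by apply/presented_eq; rewrite /presented_of reprK. Qed.

Lemma letterVK : involutive letterV.
Proof. by case=> a b; rewrite /letterV /= negbK. Qed.

Lemma wordVK : involutive wordV.
Proof.
by move=> w; rewrite /wordV map_rev revK -map_comp map_id_in // => x _ /=;
   rewrite letterVK.
Qed.

Lemma word_eqV w : word_eq (w ++ wordV w) [::].
Proof.
elim: w => [|x w IH]; first exact: word_eq_refl.
rewrite /wordV /= rev_cons -cats1 catA -cat1s.
apply: word_eq_trans (word_eq_cancel x).
rewrite -!catA (_ : [:: x; letterV x] = [:: x] ++ ([::] ++ [:: letterV x])) //.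
apply: word_eq_cat; first exact: word_eq_refl.
by rewrite catA; apply: word_eq_cat => //; exact: word_eq_refl.
Qed.

Lemma wordV_eq u v : word_eq u v -> word_eq (wordV u) (wordV v).
Proof.
move=> uv.
have step1 : word_eq (wordV u) (wordV u ++ (v ++ wordV v)).
  rewrite -{1}[wordV u]cats0; apply: word_eq_cat; first exact: word_eq_refl.
  by apply: word_eq_sym; exact: word_eqV.
apply: (word_eq_trans step1); rewrite catA -{2}[wordV v]cat0s.
apply: word_eq_cat; last exact: word_eq_refl.
have := word_eqV (wordV u); rewrite wordVK; apply: word_eq_trans.
by apply: word_eq_cat; [exact: word_eq_refl | exact: word_eq_sym].
Qed.

Definition presented_one : presented := presented_of [::].
Definition presented_mul (x y : presented) : presented :=
  presented_of (repr x ++ repr y).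
Definition presented_inv (x : presented) : presented :=
  presented_of (wordV (repr x)).

Lemma presented_mulE u v :
  presented_mul (presented_of u) (presented_of v) = presented_of (u ++ v).
Proof. by apply/presented_eq; apply: word_eq_cat; exact: repr_presented. Qed.

Lemma presented_invE u : presented_inv (presented_of u) = presented_of (wordV u).
Proof. by apply/presented_eq; apply: wordV_eq; exact: repr_presented. Qed.

Lemma presented_mulA : associative presented_mul.
Proof.
move=> x y z; have [u ->] := presentedP x; have [v ->] := presentedP y.
by have [w ->] := presentedP z; rewrite !presented_mulE catA.
Qed.

Lemma presented_mul1 : left_id presented_one presented_mul.
Proof. by move=> x; have [u ->] := presentedP x; rewrite presented_mulE. Qed.

Lemma presented_mulr1 : right_id presented_one presented_mul.
Proof.
by move=> x; have [u ->] := presentedP x; rewrite presented_mulE cats0.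
Qed.

Lemma presented_mulV : left_inverse presented_one presented_inv presented_mul.
Proof.
move=> x; have [u ->] := presentedP x.
rewrite presented_invE presented_mulE; apply/presented_eq.
by have := word_eqV (wordV u); rewrite wordVK.
Qed.

Lemma presented_mulrV : right_inverse presented_one presented_inv presented_mul.
Proof.
move=> x; have [u ->] := presentedP x.
by rewrite presented_invE presented_mulE; apply/presented_eq; exact: word_eqV.
Qed.

HB.instance Definition _ := isGroup.Build presented presented_mulA
  presented_mul1 presented_mulr1 presented_mulV presented_mulrV.

Lemma presented_of_cat u v :
  presented_of (u ++ v) = presented_of u * presented_of v.
Proof. exact/esym/presented_mulE. Qed.

Definition presented_gen (a : A) : presented := presented_of [:: (a, true)].

Section Lift.
Variables (G : groupType) (f : A -> G).

Definition letter_eval (x : letter) : G := if x.2 then f x.1 else (f x.1)^-1.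
Definition word_eval (w : word) : G := \prod_(x <- w) letter_eval x.

Hypothesis f_relator : forall w, r w -> word_eval w = 1.

Lemma word_eval_eq u v : word_eq u v -> word_eval u = word_eval v.
Proof.
elim=> {u v} [//|u v _ -> //|u v w _ -> //|u u' v v' _ IHu _ IHv|[a b]|w /f_relator ->].
- by rewrite /word_eval !big_cat /= -!/(word_eval _) IHu IHv.
- rewrite /word_eval !big_cons !big_nil mulg1 /letter_eval /=.
  by case: b; rewrite /= ?mulgV ?mulVg.
- by rewrite /word_eval big_nil.
Qed.

Definition presented_lift (x : presented) : G := word_eval (repr x).

Lemma presented_liftE w : presented_lift (presented_of w) = word_eval w.
Proof. by apply: word_eval_eq; exact: repr_presented. Qed.

Lemma presented_lift_mult : {morph presented_lift : x y / x * y >-> x * y}.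
Proof.
move=> x y; have [u ->] := presentedP x; have [v ->] := presentedP y.
by rewrite -presented_of_cat !presented_liftE /word_eval big_cat.
Qed.

Definition presented_lift_mor : {multiplicative presented -> G} :=
  HB.pack_for {multiplicative presented -> G} presented_lift
    (isMultiplicative.Build presented G presented_lift presented_lift_mult).

Lemma presented_lift_gen a : presented_lift_mor (presented_gen a) = f a.
Proof. by rewrite /= presented_liftE /word_eval big_seq1. Qed.

End Lift.
End PresentedGroup.

Definition free_group (X : Type) : groupType := @presented X set0.
Definition free_group_gen (X : Type) (x : X) : free_group X := presented_gen set0 x.

Section FreeGroupLift.
Variables (X : Type) (G : groupType) (f : X -> G).

Lemma free_group_lift_relator (w : word X) :
  @set0 (word X) w -> word_eval f w = 1.
Proof. by []. Qed.

Definition free_group_lift : {multiplicative free_group X -> G} :=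
  presented_lift_mor free_group_lift_relator.

Lemma free_group_liftE x : free_group_lift (free_group_gen x) = f x.
Proof. exact: presented_lift_gen. Qed.

End FreeGroupLift.

Section FreeProduct.
Variables (I : Type) (G_ : I -> groupType).

Inductive free_product_relator : word {i : I & G_ i} -> Prop :=
| Free_product_relator i (a b : G_ i) :
    free_product_relator
      [:: (existT _ i a, true); (existT _ i b, true); (existT _ i (a * b), false)].

Definition free_product : groupType := presented free_product_relator.
Definition free_product_in i (a : G_ i) : free_product :=
  presented_gen free_product_relator (existT _ i a).

Section Lift.
Variables (G : groupType) (f : forall i, {multiplicative G_ i -> G}).

Lemma free_product_lift_relator w :
  free_product_relator w ->
  word_eval (fun x : {i : I & G_ i} => f (projT1 x) (projT2 x)) w = 1.
Proof.
case=> i a b; rewrite /word_eval !big_cons big_nil /letter_eval /=.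
by rewrite mulg1 gmulfM mulgA mulgV.
Qed.

Definition free_product_lift : {multiplicative free_product -> G} :=
  presented_lift_mor free_product_lift_relator.

Lemma free_product_liftE i a : free_product_lift (free_product_in a) = f i a.
Proof. exact: presented_lift_gen. Qed.

End Lift.
End FreeProduct.

Section BinaryFreeProduct.
Variables A B : groupType.

Definition free_product2_factor (b : bool) : groupType := if b then A else B.
Definition free_product2 : groupType := free_product free_product2_factor.
Definition free_product2_inl (a : A) : free_product2 :=
  @free_product_in bool free_product2_factor true a.
Definition free_product2_inr (b : B) : free_product2 :=
  @free_product_in bool free_product2_factor false b.

Section Lift.
Variables (G : groupType) (f : {multiplicative A -> G}) (g : {multiplicative B -> G}).

Definition free_product2_lift : {multiplicative free_product2 -> G} :=
  @free_product_lift bool free_product2_factor G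
    (fun b => if b as b return {multiplicative free_product2_factor b -> G}
              then f else g).

Lemma free_product2_lift_inl a : free_product2_lift (free_product2_inl a) = f a.
Proof. exact: free_product_liftE. Qed.

Lemma free_product2_lift_inr b : free_product2_lift (free_product2_inr b) = g b.
Proof. exact: free_product_liftE. Qed.

End Lift.
End BinaryFreeProduct.

Section RelativePresentations.
Variables (G : groupType) (Lambda : Type) (H : Lambda -> groupClosed G).

Definition relative_generating_set (X : set G) : Prop :=
  subgroup_generated (X `|` \bigcup_i [set` H i]) = [set: G].

Definition relative_free (X : set G) : groupType :=
  free_product2 (free_product (fun i => subgroup_type (H i))) (free_group X).

Definition relative_sub_in (X : set G) i (h : subgroup_type (H i)) : relative_free X :=
  free_product2_inl _
    (@free_product_in Lambda (fun j => subgroup_type (H j)) i h).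

Definition relative_gen_in (X : set G) (x : X) : relative_free X :=
  free_product2_inr _ (free_group_gen x).

Definition relative_eps (X : set G) : {multiplicative relative_free X -> G} :=
  free_product2_lift
    (free_product_lift (fun i => subgroup_inclusion (H i)))
    (free_group_lift (fun x : X => val x)).

Lemma relative_eps_subgroup (X : set G) i (h : subgroup_type (H i)) :
  relative_eps X (relative_sub_in X h) = subgroup_incl h.
Proof. by rewrite free_product2_lift_inl free_product_liftE. Qed.

Lemma relative_eps_gen (X : set G) (x : X) :
  relative_eps X (relative_gen_in x) = val x.
Proof. by rewrite free_product2_lift_inr free_group_liftE. Qed.

Definition relative_presentation (X : set G) (R : set (relative_free X)) : Prop :=
  relative_generating_set X /\ kernel (relative_eps X) = normal_closure R.

Definition relatively_finitely_presented : Prop :=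
  exists (X : set G) (R : set (relative_free X)),
    [/\ finite_set X, finite_set R & relative_presentation R].

End RelativePresentations.

(* Main.v *)
(* Write the finitely many relators and, for finitely many generators of [G],  *)
(* preimages in the relative free group [F] as products of letters, and let    *)
(* [K i] be the subgroup of [H i] generated by the finitely many letters from  *)
(* [H i] that occur. Any two homomorphisms [f1], [f2] from [F] that agree on   *)
(* [X] and on all the [K i], where [f1] kills the kernel of [eps], agree on    *)
(* the relators, hence both factor through [G]; they agree on preimages of     *)
(* generators of [G], so they are equal. If [K i] were proper in [H i], this   *)
(* would fail for [f1] = [eps] followed by [G -> (Z/2)^G ><| G] and [f2] = the *)
(* same map with each factor [H i] conjugated by the indicator function of     *)
(* [K i]: the elements of [H i] commuting with that indicator are those of     *)
(* [K i]. So [H i] = [K i] for all [i]; as only finitely many [H i] contribute *)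
(* a letter and the [H i] are nontrivial, the index set is finite.             *)
From Stdlib Require Eqdep_dec.
Require Import Defs.
From HB Require Import structures.
From mathcomp Require Import all_boot.
From mathcomp Require Import boolp classical_sets cardinality.

Set Implicit Arguments.
Unset Strict Implicit.
Unset Printing Implicit Defensive.

Local Open Scope classical_set_scope.
Local Open Scope group_scope.

(** Words and normal forms in the relative free group are avoided: the letters of an element are
    recorded by [supported_by], a condition on homomorphisms, and by [finitely_supported] finitely
    many always suffice. [supported_lift_eq] is the rigidity that finite data [L] impose on maps
    killing the kernel of [eps]. [subgroup_generated_support] plays it against the freedom to
    conjugate each factor separately, with [lamp_conjP] detecting membership in [K i]; hence [L]
    generates every [H i]. *)

Section SubgroupLemmas.
Variables G H : groupType.
Implicit Types (A K : set G).

(* Monoid.v proves these only for [UMagmaMorphism]s, although between groups  *)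
(* every multiplicative map preserves [1].                                    *)
Lemma mult_mor1 (f : {multiplicative G -> H}) : f 1 = 1.
Proof. by apply: (@mulgI _ (f 1)); rewrite -gmulfM !mulg1. Qed.

Lemma mult_morF (f : {multiplicative G -> H}) : {morph f : x y / x / y}.
Proof. by move=> x y; apply: (canRL (mulgK _)); rewrite -gmulfM divgK. Qed.

Lemma mult_morV (f : {multiplicative G -> H}) : {morph f : x / x^-1}.
Proof. by move=> x; rewrite -div1g mult_morF mult_mor1 div1g. Qed.

Lemma mult_morJ (f : {multiplicative G -> H}) : {morph f : x y / x ^ y}.
Proof. by move=> x y; apply: (@mulgI _ (f y)); rewrite -conjgC -!gmulfM -conjgC. Qed.

Lemma is_subgroupV K x : is_subgroup K -> K x -> K x^-1.
Proof. by case=> K1 KF Kx; rewrite -div1g; exact: KF. Qed.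

Lemma is_subgroupM K x y : is_subgroup K -> K x -> K y -> K (x * y).
Proof.
move=> sK Kx Ky; rewrite -[y]invgK; case: (sK) => _; apply=> //.
exact: is_subgroupV.
Qed.

Lemma is_subgroup_generated A : is_subgroup (subgroup_generated A).
Proof.
split=> [K [[]]//|x y Ax Ay K KA]; case: (KA) => -[_ KF] _.
by apply: KF; [exact: Ax | exact: Ay].
Qed.

Lemma is_subgroup_preimage (f : {multiplicative G -> H}) (L : set H) :
  is_subgroup L -> is_subgroup (f @^-1` L).
Proof.
case=> L1 LF; split=> [|x y]; rewrite /preimage /=; first by rewrite mult_mor1.
by rewrite mult_morF; exact: LF.
Qed.

Lemma is_subgroup_image (f : {multiplicative G -> H}) K :
  is_subgroup K -> is_subgroup (f @` K).
Proof.
case=> K1 KF; split; first by exists 1 => //; rewrite mult_mor1.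
by move=> _ _ [x Kx <-] [y Ky <-]; exists (x / y); [exact: KF | rewrite mult_morF].
Qed.

Lemma is_subgroup_equalizer (f g : {multiplicative G -> H}) :
  is_subgroup [set x | f x = g x].
Proof. by split=> [|x y /= fx fy]; rewrite /= ?mult_mor1 // !mult_morF fx fy. Qed.

Lemma is_normal_subgroup_kernel (f : {multiplicative G -> H}) :
  is_normal_subgroup (kernel f).
Proof.
split=> [|x g /= fx]; last by rewrite /kernel /= mult_morJ fx conj1g.
by split=> [|x y /= fx fy]; rewrite /kernel /= ?mult_mor1 // mult_morF fx fy divg1.
Qed.

Lemma conj_morM (f : {multiplicative G -> H}) (c : H) :
  {morph (fun x => f x ^ c) : x y / x * y}.
Proof. by move=> x y; rewrite gmulfM conjMg. Qed.

Definition conj_mor (f : {multiplicative G -> H}) (c : H) :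
    {multiplicative G -> H} :=
  HB.pack_for {multiplicative G -> H} (fun x => f x ^ c)
    (isMultiplicative.Build G H (fun x => f x ^ c) (conj_morM f c)).

End SubgroupLemmas.

(** * Generation of presented groups and embeddings of free factors *)

Section FreeProductLemmas.

Lemma presented_ofV (A : Type) (r : set (word A)) w :
  presented_of r (wordV w) = (presented_of r w)^-1.
Proof. exact/esym/presented_invE. Qed.

Lemma presented_ind (A : Type) (r : set (word A)) (P : set (presented r)) :
  is_subgroup P -> (forall a, P (presented_gen r a)) -> forall x, P x.
Proof.
move=> sP Pgen x; have [w ->] := presentedP x.
elim: w => [|[a b] w IHw]; first exact: sP.1.
rewrite -cat1s presented_of_cat; apply: is_subgroupM => //.
case: b; first exact: Pgen.
rewrite (presented_ofV r [:: (a, true)]); apply: is_subgroupV => //; exact: Pgen.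
Qed.

Variables (I : Type) (G_ : I -> groupType).

Lemma free_product_inM i :
  {morph @free_product_in I G_ i : a b / a * b >-> a * b}.
Proof.
move=> a b; apply/esym/divg1_eq.
have /word_eq_relator/presented_eq := Free_product_relator a b.
rewrite -cat1s presented_of_cat -[X in _ * presented_of _ X]cat1s.
rewrite presented_of_cat mulgA.
by rewrite (presented_ofV _ [:: (existT _ i (a * b), true)]).
Qed.

Definition free_product_in_mor i : {multiplicative G_ i -> free_product G_} :=
  HB.pack_for {multiplicative G_ i -> free_product G_} (@free_product_in I G_ i)
    (isMultiplicative.Build (G_ i) (free_product G_) (@free_product_in I G_ i)
       (@free_product_inM i)).

End FreeProductLemmas.

(* The semidirect product of the functions [G -> Z/2] by [G], the latter      *)
(* acting by translations; [(c, g)] stands for [g] times [c].                 *)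
Section Lamplighter.
Variable G : groupType.

Definition lamplighter := ((G -> bool) * G)%type.
HB.instance Definition _ := gen_eqMixin lamplighter.
HB.instance Definition _ := gen_choiceMixin lamplighter.

Definition lamp_one : lamplighter := (fun=> false, 1).
Definition lamp_mul (u v : lamplighter) : lamplighter :=
  (fun x => u.1 (v.2 * x) (+) v.1 x, u.2 * v.2).
Definition lamp_inv (u : lamplighter) : lamplighter :=
  (fun x => u.1 (u.2^-1 * x), u.2^-1).

Lemma lamp_mulA : associative lamp_mul.
Proof.
move=> u v w; rewrite /lamp_mul /= mulgA; congr pair.
by apply/funext => x; rewrite addbA !mulgA.
Qed.

Lemma lamp_mul1 : left_id lamp_one lamp_mul.
Proof. by case=> c g; rewrite /lamp_mul /= mul1g. Qed.

Lemma lamp_mulr1 : right_id lamp_one lamp_mul.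
Proof.
case=> c g; rewrite /lamp_mul /= mulg1; congr pair.
by apply/funext => x; rewrite mul1g addbF.
Qed.

Lemma lamp_mulV : left_inverse lamp_one lamp_inv lamp_mul.
Proof.
case=> c g; rewrite /lamp_mul /= mulVg; congr pair.
by apply/funext => x; rewrite mulKg addbb.
Qed.

Lemma lamp_mulrV : right_inverse lamp_one lamp_inv lamp_mul.
Proof.
case=> c g; rewrite /lamp_mul /= mulgV; congr pair.
by apply/funext => x; rewrite addbb.
Qed.

HB.instance Definition _ := isGroup.Build lamplighter lamp_mulA
  lamp_mul1 lamp_mulr1 lamp_mulV lamp_mulrV.

Definition lamp_in (g : G) : lamplighter := (fun=> false, g).
Definition lamp_fun (c : G -> bool) : lamplighter := (c, 1).

Lemma lamp_inM : {morph lamp_in : g h / g * h >-> g * h}.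
Proof. by []. Qed.

HB.instance Definition _ := isMultiplicative.Build G lamplighter lamp_in lamp_inM.

(** Being fixed by conjugation means commuting, and the two products differ only in their lamp
    parts, [c] translated by [g] and [c] itself. *)
Lemma lamp_conjP (c : G -> bool) g :
  lamp_in g ^ lamp_fun c = lamp_in g <-> forall x, c (g * x) = c x.
Proof.
have -> : (lamp_in g ^ lamp_fun c = lamp_in g) =
          (lamp_fun c * lamp_in g = lamp_in g * lamp_fun c).
  rewrite (conjgC (lamp_in g)); apply/propext.
  by split=> [->|/mulgI/esym].
have -> : lamp_fun c * lamp_in g = (fun x => c (g * x), g).
  rewrite [LHS]/(lamp_mul _ _) /lamp_mul /= mul1g; congr pair.
  by apply/funext => x; rewrite addbF.
have -> : lamp_in g * lamp_fun c = (c, g).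
  by rewrite [LHS]/(lamp_mul _ _) /lamp_mul /= mulg1.
by split=> [[/[swap] x /(congr1 (@^~ x))]//|cg]; congr pair; exact/funext.
Qed.

End Lamplighter.

(** * Finite supports in the relative free group *)

Section RelativeFreeGroup.
Variables (G : groupType) (Lambda : Type) (H : Lambda -> groupClosed G).
Variable X : set G.

Local Notation F := (relative_free H X).

(** The group is a free product whose factors are themselves presented, so generation is used twice,
    with [P] pulled back to each factor. *)
Lemma relative_free_ind (P : set F) :
  is_subgroup P ->
  (forall i (h : subgroup_type (H i)), P (relative_sub_in X h)) ->
  (forall x : X, P (relative_gen_in H x)) ->
  forall x, P x.
Proof.
move=> sP Psub Pgen; apply: presented_ind => // -[[] y].
- pose inl : {multiplicative _ -> F} := @free_product_in_mor _
    (free_product2_factor (free_product (fun i => subgroup_type (H i)))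
       (free_group X)) true.
  apply: (@presented_ind _ _ (inl @^-1` P)); first exact: is_subgroup_preimage.
  by case=> i h; exact: Psub.
- pose inr : {multiplicative _ -> F} := @free_product_in_mor _
    (free_product2_factor (free_product (fun i => subgroup_type (H i)))
       (free_group X)) false.
  apply: (@presented_ind _ _ (inr @^-1` P)); first exact: is_subgroup_preimage.
  by move=> x; exact: Pgen.
Qed.

Section Lift.
Variables (K : groupType) (f : forall i, {multiplicative subgroup_type (H i) -> K}).
Variable g : X -> K.

Definition relative_lift : {multiplicative F -> K} :=
  free_product2_lift (free_product_lift f) (free_group_lift g).

Lemma relative_lift_sub i (h : subgroup_type (H i)) :
  relative_lift (relative_sub_in X h) = f i h.
Proof. by rewrite [LHS]free_product2_lift_inl free_product_liftE. Qed.

Lemma relative_lift_gen (x : X) : relative_lift (relative_gen_in H x) = g x.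
Proof. by rewrite [LHS]free_product2_lift_inr free_group_liftE. Qed.

End Lift.

Definition agree_on (L : set {i & subgroup_type (H i)}) (K : groupType)
    (f g : {multiplicative F -> K}) :=
  (forall x : X, f (relative_gen_in H x) = g (relative_gen_in H x)) /\
  forall i h, L (existT _ i h) -> f (relative_sub_in X h) = g (relative_sub_in X h).

(** Substitute for [x] being a product of generators from [X], letters in [L] and their inverses,
    without choosing a word. *)
Definition supported_by (L : set {i & subgroup_type (H i)}) (x : F) :=
  forall (K : groupType) (f g : {multiplicative F -> K}), agree_on L f g -> f x = g x.

Lemma sub_supported (L L' : set {i & subgroup_type (H i)}) (x : F) :
  L `<=` L' -> supported_by L x -> supported_by L' x.
Proof.
by move=> LL' Lx K f g [fgX fgL]; apply: Lx; split=> // i h /LL'; exact: fgL.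
Qed.

Lemma finitely_supported (x : F) : exists2 L, finite_set L & supported_by L x.
Proof.
apply: (@relative_free_ind (fun x => exists2 L, finite_set L & supported_by L x)).
- split; first by exists set0 => // K f g _; rewrite !mult_mor1.
  move=> {}x y [L Lfin Lx] [L' L'fin L'y]; exists (L `|` L').
    by rewrite finite_setU.
  move=> K f g fg; rewrite !mult_morF.
  rewrite (sub_supported (@subsetUl _ _ _) Lx fg).
  by rewrite (sub_supported (@subsetUr _ _ _) L'y fg).
- move=> i h; exists [set existT _ i h]; first exact: finite_set1.
  by move=> K f g [_]; exact.
- by move=> y; exists set0 => // K f g [].
Qed.

Lemma finitely_supported_set (A : set F) :
  finite_set A -> exists2 L, finite_set L & A `<=` supported_by L.
Proof.
move=> Afin; have /choice[L LP] x : exists L, finite_set L /\ supported_by L x.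
  by have [L ? ?] := finitely_supported x; exists L.
exists (\bigcup_(x in A) L x).
  by apply: bigcup_finite => // x _; exact: (LP x).1.
by move=> x Ax; apply: sub_supported (LP x).2; exact: bigcup_sup.
Qed.

Lemma relative_eps_surj :
  relative_generating_set H X -> forall g, exists x, relative_eps H X x = g.
Proof.
move=> genX g; have: [set: G] g by []; rewrite -genX.
suff: subgroup_generated (X `|` \bigcup_i [set` H i]) `<=`
      relative_eps H X @` setT by move=> /[apply] -[x _ <-]; exists x.
apply: smallest_sub; first by apply: is_subgroup_image; split.
move=> x [Xx|[i _ Hx]].
  exists (relative_gen_in H (exist _ x (mem_set Xx))) => //.
  by rewrite relative_eps_gen.
exists (relative_sub_in X (Subgroup Hx)) => //.
by rewrite relative_eps_subgroup.
Qed.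

End RelativeFreeGroup.

(** * Rigidity and the conjugation trick *)

Section FinitePresentation.
Variables (G : groupType) (Lambda : Type) (H : Lambda -> groupClosed G).
Variables (X : set G) (R : set (relative_free H X)).
Hypothesis presR : relative_presentation R.

Local Notation eps := (relative_eps H X).

(** Since [g] agrees with [f] on the relators, it kills them too, so both maps factor through [G];
    there they agree on the generators [A]. *)
Lemma supported_lift_eq (A : set G) (B : set (relative_free H X))
    (L : set {i & subgroup_type (H i)}) (K : groupType)
    (f g : {multiplicative relative_free H X -> K}) :
  subgroup_generated A = setT -> A `<=` eps @` B ->
  R `|` B `<=` supported_by L -> agree_on L f g -> kernel eps `<=` kernel f ->
  f =1 g.
Proof.
move=> genA AB RBL fg keps.
have kepsg : kernel eps `<=` kernel g.
  rewrite presR.2; apply: smallest_sub; first exact: is_normal_subgroup_kernel.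
  move=> x Rx; rewrite /kernel /= -(RBL x _ _ _ _ fg); last by left.
  by apply: keps; rewrite presR.2; exact: sub_gen_smallest.
move=> y; have: [set: G] (eps y) by []; rewrite -genA.
(* Then some [x] with [f x = g x] has the same image as [y], and both maps kill [y / x]. *)
suff: subgroup_generated A `<=` eps @` [set x | f x = g x].
  move=> /[apply] -[x fgx epsxy].
  have xy : kernel eps (y / x).
    by apply: etrans (mult_morF eps y x) _; rewrite epsxy mulgV.
  have := keps _ xy; have := kepsg _ xy.
  by rewrite /kernel /= !mult_morF => /divg1_eq -> /divg1_eq ->.
apply: smallest_sub; first exact/is_subgroup_image/is_subgroup_equalizer.
by move=> a /AB[x Bx <-]; exists x => //; apply: RBL fg; right.
Qed.

Lemma subgroup_generated_support (A : set G) (B : set (relative_free H X))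
    (L : set {i & subgroup_type (H i)}) :
  subgroup_generated A = setT -> A `<=` eps @` B ->
  R `|` B `<=` supported_by L ->
  forall i, subgroup_generated [set h : subgroup_type (H i) | L (existT _ i h)] = setT.
Proof.
move=> genA AB RBL.
pose K i := subgroup_generated [set h : subgroup_type (H i) | L (existT _ i h)].
have KP i : is_subgroup (K i) by exact: is_subgroup_generated.
pose c i (x : G) := `[< exists2 h, K i h & subgroup_incl h = x >].
pose f1 : {multiplicative relative_free H X -> lamplighter G} := @lamp_in G \o eps.
have f1E x : f1 x = lamp_in (eps x) by [].
(* Freeness allows a different conjugator on each factor; no relator has to be checked. *)
pose f2 := relative_lift
  (fun i => conj_mor (@lamp_in G \o subgroup_inclusion (H i)) (lamp_fun (c i)))
  (fun x : X => lamp_in (val x)).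
have f12 : f1 =1 f2.
  apply: (supported_lift_eq genA AB RBL).
    split=> [x|i h Lh].
      by rewrite relative_lift_gen f1E relative_eps_gen.
    (* Left translation by an element of [K i] preserves the indicator of [K i]. *)
    rewrite relative_lift_sub f1E relative_eps_subgroup; apply/esym/lamp_conjP => x.
    have Kh : K i h by exact: sub_gen_smallest.
    pose inc := subgroup_inclusion (H i).
    apply/asboolP/asboolP => -[k Kk kx].
      exists (h^-1 * k); first exact: is_subgroupM (is_subgroupV _ Kh) Kk.
      rewrite [LHS](@gmulfM _ _ inc (h^-1) k).
      by rewrite mult_morV -[RHS](mulKg (inc h)) [inc k]kx.
    exists (h * k); first exact: (is_subgroupM (KP i)).
    by rewrite [LHS](@gmulfM _ _ inc h k) -kx.
  by move=> x epsx; rewrite /kernel /= [LHS]f1E epsx mult_mor1.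
move=> i; apply/seteqP; split=> // h _.
(* Conversely, invariance of the indicator under [h], evaluated at [1], puts [h] in [K i]. *)
have /esym := f12 (relative_sub_in X h).
rewrite relative_lift_sub f1E relative_eps_subgroup => /lamp_conjP /(_ 1).
rewrite mulg1 /c => ch.
have: `[< exists2 k, K i k & subgroup_incl k = 1 >].
  by apply/asboolP; exists 1 => //; exact: (KP i).1.
by rewrite -ch => /asboolP[k Kk /val_inj <-].
Qed.

End FinitePresentation.

Theorem theorem1p1 (G : groupType) (Lambda : Type) (H : Lambda -> groupClosed G)
    (G_fg : finitely_generated G)
    (H_nontrivial : forall i : Lambda, [set` H i] <> [set 1])
    (G_rfp : relatively_finitely_presented H) :
  finite_set [set: Lambda] /\
  forall i : Lambda, finitely_generated (subgroup_type (H i)).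
Proof.
have [A [Afin genA]] := G_fg.
have [X [R [Xfin Rfin presR]]] := G_rfp.
have /choice[lift liftE] := relative_eps_surj presR.1.
pose B := lift @` A.
have AB : A `<=` relative_eps H X @` B.
  by move=> a Aa; exists (lift a) => //; exists a.
have /finitely_supported_set[L Lfin RBL] : finite_set (R `|` B).
  by rewrite finite_setU; split=> //; exact: finite_image.
have genL := subgroup_generated_support presR genA AB RBL.
split=> [|i]; last first.
  exists [set h | L (existT _ i h)]; split; last exact: genL.
  (* Injectivity of [existT _ i] rests on classically decidable equality of indices. *)
  apply: (finite_preimage _ Lfin) => h k _ _.
  exact: (Eqdep_dec.inj_pair2_eq_dec _ (fun i j => pselect (i = j))).
apply: (sub_finite_set _ (finite_image (@projT1 _ _) Lfin)) => i _ /=.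
(* An index absent from [L] would make [H i] generated by the empty set, hence trivial. *)
apply: contrapT => Li; apply: (H_nontrivial i).
apply/seteqP; split=> [x Hx|_ ->]; last exact: gpred1.
have: [set: subgroup_type (H i)] (Subgroup Hx) by []; rewrite -genL.
suff /[apply] /(congr1 (@subgroup_incl _ _)) :
    subgroup_generated [set h : subgroup_type (H i) | L (existT _ i h)]
      `<=` [set 1] by [].
apply: smallest_sub; first by split=> // _ _ -> ->; exact: divg1.
by move=> h Lh; case: Li; exists (existT _ i h).
Qed.
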